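(* Let $r\ge t\ge 2$ be integers. The class $\mathscr{S}^{\blacktriangleleft}_<(r,t)$ of ordered Steiner $(r,t)$-systems, whose subobjects are strongly induced subsystems, is a Ramsey class. That is, for all $F_<,G_<\in\mathscr{S}^{\blacktriangleleft}_<(r,t)$ and every positive integer $c$ there exists $H_<\in\mathscr{S}^{\blacktriangleleft}_<(r,t)$ such that for every colouring of $\binom{H_<}{F_<}_{\blacktriangleleft}$ with $c$ colours there is some $\widetilde G_<\in\binom{H_<}{G_<}_{\blacktriangleleft}$ for which $\binom{\widetilde G_<}{F_<}_{\blacktriangleleft}$ is monochromatic.
   Context: An $r$-uniform hypergraph ($r$-graph) is a pair $G=(V,E)$ with $E\subseteq\binom{V}{r}$. For $r$-graphs $G,H$, $G$ is an induced subhypergraph of $H$ ($G\le H$) if $V(G)\subseteq V(H)$ and $E(G)=E(H)\cap\binom{V(G)}{r}$. For integers $r\ge t\ge2$, a Steiner $(r,t)$-system is an $r$-graph in which every $t$-element subset of the vertex set is contained in at most one edge. For Steiner $(r,t)$-systems $G,H$, $G$ is a strongly induced subsystem of $H$ ($G\blacktriangleleft H$) if $G\le H$ and $|e\cap V(G)|<t$ for all $e\in E(H)\setminus E(G)$. An ordered Steiner $(r,t)$-system is a Steiner $(r,t)$-system with a fixed linear order on its vertex set; subsystems carry the restricted order, and isomorphisms are required to be order-preserving. $\mathscr{S}^{\blacktriangleleft}_<(r,t)$ denotes the class of ordered Steiner $(r,t)$-systems with order-preserving isomorphisms and with strongly induced subsystems as subobjects; for $F_<,G_<$ in this class, $\binom{G_<}{F_<}_{\blacktriangleleft}$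 is the set of strongly induced subsystems of $G_<$ (with inherited order) that are order-isomorphic to $F_<$. A class is a Ramsey class if it has the property stated in the claim for all $F,G$ and $c$. *)

(* Defs.v *)
From HB Require Import structures.
From mathcomp Require Import all_boot all_order.

Set Implicit Arguments.
Unset Strict Implicit.
Unset Printing Implicit Defensive.

(* A finite (ordered) hypergraph is a vertex set and an edge set inside an    *)
(* ambient finite totally ordered type T; the vertices are ordered by         *)
(* restricting the order of T. Any finite linearly ordered set is the vertex  *)
(* set of such an object, and subobjects live in the same ambient type and    *)
(* so carry the restricted order.                                             *)
Record hypergraph (T : finType) := Hypergraph {
  vertices : {set T};
  edges : {set {set T}}
}.

Definition rsubsets (T : finType) (r : nat) (V : {set T}) : {set {set T}} :=
  [set e : {set T} | e \subset V & #|e| == r].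

Definition uniform (T : finType) (r : nat) (G : hypergraph T) : Prop :=
  edges G \subset rsubsets r (vertices G).

Definition steiner (T : finType) (r t : nat) (G : hypergraph T) : Prop :=
  uniform r G /\
  forall S : {set T}, S \in rsubsets t (vertices G) ->
    #|[set e in edges G | S \subset e]| <= 1.

Definition induced (T : finType) (r : nat) (G H : hypergraph T) : Prop :=
  vertices G \subset vertices H /\
  edges G = edges H :&: rsubsets r (vertices G).

Definition strongly_induced (T : finType) (r t : nat) (G H : hypergraph T) :
    Prop :=
  induced r G H /\
  forall e : {set T}, e \in edges H :\: edges G -> #|e :&: vertices G| < t.

(* Isomorphisms are maps between the vertex sets themselves, not between the  *)
(* ambient types, so that the empty hypergraph on an inhabited ambient type   *)
(* is isomorphic to the one on an empty ambient type.                         *)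
Definition vertex (T : finType) (G : hypergraph T) : finType :=
  {x : T | x \in vertices G}.

Definition order_iso (d d' : Order.disp_t)
    (T : finOrderType d) (T' : finOrderType d')
    (G : hypergraph T) (G' : hypergraph T') : Prop :=
  exists f : vertex G -> vertex G',
    [/\ bijective f,
        forall x y : vertex G,
          (sval (f x) <= sval (f y))%O = (sval x <= sval y)%O
      & forall e : {set vertex G},
          ([set sval (f x) | x in e] \in edges G')
          = ([set sval x | x in e] \in edges G)].

(* copy r t F H K : K belongs to the set of strongly induced subsystems of H  *)
(* that are order-isomorphic to F. If H is a Steiner (r,t)-system then so is  *)
(* K, because K is induced in H.                                              *)
Definition copy (d d' : Order.disp_t) (r t : nat)
    (TF : finOrderType d) (TH : finOrderType d')
    (F : hypergraph TF) (H K : hypergraph TH) : Prop :=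
  strongly_induced r t K H /\ order_iso K F.

(* Main.v *)
Require Import Defs.
From mathcomp Require Import all_boot all_order.

Set Implicit Arguments.
Unset Strict Implicit.
Unset Printing Implicit Defensive.

Import Order.Theory.

(* A partite construction, with a second one nested in its partite lemma.     *)
(* Systems live over an index set I, with edges transversal to the fibres. A  *)
(* Ramsey number n gives the index set of the outer construction, which       *)
(* starts from a disjoint union of copies of G, one above each |V(G)|-subset  *)
(* of {0, ..., n}. For each |V(F)|-subset K in turn, one takes the part B of  *)
(* the current system P whose edges lie over the edges of the unique copy of  *)
(* F on K, applies the partite lemma to B, and extends every copy of B so     *)
(* obtained to a copy of P, freely. At the end the colour of a copy of F      *)
(* depends only on its projection, and Ramsey's theorem applies.              *)
(*                                                                            *)
(* The free extension can destroy the Steiner property only on a t-set of B   *)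
(* that lies in an edge of P outside B and in two copies of B. Such a t-set   *)
(* lies in no copy of F, as these are strongly induced. So it suffices that   *)
(* two copies of B never share a set which lies in no copy of F. The          *)
(* Hales-Jewett power C of B does not have this property, but another partite *)
(* construction, over the index set V(C), enforces it; there no edge sticks   *)
(* out of the parts that are amalgamated, since copies of F are strongly      *)
(* induced in C.                                                              *)

(** * Finite sets *)

(** Increasing bijections between finite linear orders are unique. So the projection of a copy of
    [F] to the ordered index set determines where each vertex and edge of [F] goes
    ([order_iso_transport]). Once copies of [F] with the same projection have the same colour, the
    colouring descends to |V(F)|-subsets of the index set. Then [ramsey] gives a set M of |V(G)|
    indices on which it is constant, and the copy of [G] above M is monochromatic.

    The colour over one index set K is fixed by [partite_step_any]. In [partite_lemma] the letters
    are copies of [F], a word is a copy in the power, and a combinatorial line is an embedding of B,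
    so [hales_jewett] makes the copies inside one B agree. The separation needed to extend these
    embeddings to P is supplied by [clean_partite_lemma], and [amalg_extension] performs the
    extension. Steps over different K are composed by [iterated_steps], which serves both the outer
    construction and the nested one. *)

Lemma subset_with_card (T : finType) (A : {set T}) (k : nat) :
  k <= #|A| -> exists2 S : {set T}, S \subset A & #|S| = k.
Proof.
move=> leA; exists [set y in take k (enum A)].
  by apply/subsetP => y; rewrite inE => /mem_take; rewrite mem_enum.
rewrite cardsE (card_uniqP (take_uniq k (enum_uniq A))) size_take -cardE.
by case: ltngtP leA.
Qed.

Lemma subset_imsetE (T T' : finType) (f : T -> T') (A : {set T})
    (B : {set T'}) :
  B \subset f @: A -> exists2 S : {set T}, S \subset A & B = f @: S.
Proof.
move=> /subsetP BA; exists (A :&: f @^-1: B); first exact: subsetIl.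
apply/setP => y; apply/idP/imsetP => [yB|[x]].
  by have /imsetP [x xA yx] := BA _ yB; exists x => //; rewrite !inE xA -yx.
by rewrite !inE => /andP [_ xB] ->.
Qed.

Lemma imset_inj_in (T T' : finType) (f : T -> T') (D A B : {set T}) :
  {in D &, injective f} -> A \subset D -> B \subset D ->
  f @: A = f @: B -> A = B.
Proof.
move=> finj; wlog suff: A B / A \subset D -> B \subset D -> f @: A = f @: B ->
    A \subset B.
  move=> h AD BD AB; apply/eqP; rewrite eqEsubset.
  by apply/andP; split; apply: h.
move=> /subsetP AD /subsetP BD AB; apply/subsetP => x xA.
have : f x \in f @: B by rewrite -AB imset_f.
by case/imsetP => y yB /finj -> //; [apply: AD | apply: BD].
Qed.

(** * The Hales-Jewett theorem *)

Definition line_at (D L : finType) (l : {ffun D -> option L}) (x : L) :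
    {ffun D -> L} := [ffun d => odflt x (l d)].

Definition cat_ffun (D1 D2 : finType) (T : Type) (f : {ffun D1 -> T})
    (g : {ffun D2 -> T}) : {ffun D1 + D2 -> T} :=
  [ffun d => match d with inl a => f a | inr b => g b end].

Definition cst_line (D L : finType) (w : {ffun D -> L}) :
    {ffun D -> option L} := [ffun d => Some (w d)].

Lemma line_at_cat (D1 D2 L : finType) (l1 : {ffun D1 -> option L})
    (l2 : {ffun D2 -> option L}) (x : L) :
  line_at (cat_ffun l1 l2) x = cat_ffun (line_at l1 x) (line_at l2 x).
Proof. by apply/ffunP => -[d|d]; rewrite !ffunE. Qed.

Lemma line_at_cst (D L : finType) (w : {ffun D -> L}) (x : L) :
  line_at (cst_line w) x = w.
Proof. by apply/ffunP => d; rewrite !ffunE. Qed.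

(* Only the letters of B have to give the same colour, while the fixed        *)
(* coordinates of the line may carry any letter of L: this way the induction  *)
(* on the alphabet is an induction on B inside a fixed type.                  *)
Definition hales_jewett_for (L : finType) (B : seq L) : Prop :=
  forall Col : finType, exists D : finType,
    forall chi : {ffun D -> L} -> Col,
    exists l : {ffun D -> option L}, (exists d, l d = None) /\
      {in B &, forall x y, chi (line_at l x) = chi (line_at l y)}.

Definition focused (D L Col : finType) (chi : {ffun D -> L} -> Col)
    (x y0 : L) (B : seq L) (f : {ffun D -> L})
    (ls : seq {ffun D -> option L}) : Prop :=
  uniq [seq chi (line_at l y0) | l : {ffun D -> option L} <- ls] /\
  forall l, l \in ls -> [/\ exists d, l d = None, line_at l x = f &
    forall y, y \in B -> chi (line_at l y) = chi (line_at l y0)].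

(** Colour focusing. The words on a new block [D'] are coloured by the whole colouring they induce
    on words over [D], and a line there makes this colouring independent of the letter in [y0 :: B].
    If the old focus has the colour of one of the focused lines, that line is monochromatic at [x]
    too; otherwise it yields one more focused line. *)
Lemma hales_jewett_focus (L : finType) (x y0 : L) (B : seq L) :
  hales_jewett_for (y0 :: B) ->
  forall (Col : finType) (s : nat), exists D : finType,
    forall chi : {ffun D -> L} -> Col,
    (exists l : {ffun D -> option L}, (exists d, l d = None) /\
      {in x :: y0 :: B &, forall x y, chi (line_at l x) = chi (line_at l y)})
    \/ (exists f ls, focused chi x y0 B f ls /\ size ls = s).
Proof.
move=> hB Col; elim=> [|s [D hD]].
  exists unit => chi; right; exists [ffun=> x], [::].
  by split=> //; split.
have [D' hD'] := hB {ffun {ffun D -> L} -> Col}.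
exists (D' + D)%type => chi.
have [l' [[d' l'd'] l'mono]] :=
  hD' (fun w => [ffun v => chi (cat_ffun w v)]).
pose chi' v := chi (cat_ffun (line_at l' y0) v).
have chi'E y v : y \in y0 :: B -> chi (cat_ffun (line_at l' y) v) = chi' v.
  move=> yB; have /ffunP/(_ v) := l'mono _ _ yB (mem_head _ _).
  by rewrite !ffunE.
have vert (l : {ffun D -> option L}) : (exists d, l d = None) ->
    {in x :: y0 :: B &, forall x y, chi' (line_at l x) = chi' (line_at l y)} ->
    exists l : {ffun D' + D -> option L}, (exists d, l d = None) /\
      {in x :: y0 :: B &, forall x y, chi (line_at l x) = chi (line_at l y)}.
  move=> [d ld] lmono.
  exists (cat_ffun (cst_line (line_at l' y0)) l); split.
    by exists (inr d); rewrite ffunE.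
  by move=> a b ain bin; rewrite !line_at_cat !line_at_cst; apply: lmono.
case: (hD chi') => [[l [ld lmono]]|[f [ls [[luniq lfoc] lsize]]]].
  by left; apply: vert lmono.
case: (boolP (chi' f \in
  [seq chi' (line_at l y0) | l : {ffun D -> option L} <- ls])).
  case/mapP => l lin fE; have [ld lx lB] := lfoc _ lin.
  left; apply: (vert l) => // a b.
  have cE z : z \in x :: y0 :: B -> chi' (line_at l z) = chi' (line_at l y0).
    rewrite !inE => /or3P [/eqP->|/eqP->|zB] //; last exact: lB.
    by rewrite lx.
  by move=> /cE -> /cE ->.
move=> fnew; right.
(* The new line moves on [D'] only and rests at the old focus on [D]; the old lines now move on both
   blocks. *)
exists (cat_ffun (line_at l' x) f).
exists (cat_ffun l' (cst_line f) ::
  [seq cat_ffun l' l | l : {ffun D -> option L} <- ls]).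
split; last by rewrite /= size_map lsize.
have cE y l : y \in y0 :: B ->
    chi (line_at (cat_ffun l' l) y) = chi' (line_at l y).
  by move=> yB; rewrite line_at_cat chi'E.
split.
  rewrite /= cE ?mem_head // line_at_cst -map_comp.
  rewrite (eq_map (g := fun l : {ffun D -> option L} => chi' (line_at l y0))).
    by rewrite fnew.
  by move=> l /=; rewrite cE ?mem_head.
move=> l; rewrite inE => /orP [/eqP-> | /mapP [l2 l2in ->]].
  split; first by exists (inl d'); rewrite ffunE.
    by rewrite line_at_cat line_at_cst.
  by move=> y yB; rewrite !cE ?line_at_cst ?inE ?eqxx ?yB ?orbT.
have [_ l2x l2B] := lfoc _ l2in; split.
- by exists (inl d'); rewrite ffunE.
- by rewrite line_at_cat l2x.
- by move=> y yB; rewrite !cE ?inE ?eqxx ?yB ?orbT ?l2B.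
Qed.

Lemma hales_jewett_seq (L : finType) (B : seq L) : hales_jewett_for B.
Proof.
elim: B => [|x [|y0 B] hB] Col.
- exists unit => chi; exists [ffun=> None].
  by split=> //; exists tt; rewrite ffunE.
- exists unit => chi; exists [ffun=> None].
  split; first by exists tt; rewrite ffunE.
  by move=> a b; rewrite !inE => /eqP-> /eqP->.
have [D hD] := hales_jewett_focus x hB Col #|Col|.+1.
exists D => chi; case: (hD chi) => [//|[f [ls [[luniq _] lsize]]]].
(* There would be more focused lines, of distinct colours, than colours. *)
by have := max_card
  (mem [seq chi (line_at l y0) | l : {ffun D -> option L} <- ls]);
  rewrite (card_uniqP luniq) size_map lsize ltnn.
Qed.

Theorem hales_jewett (L Col : finType) :
  exists D : finType, forall chi : {ffun D -> L} -> Col,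
    exists l : {ffun D -> option L}, (exists d, l d = None) /\
      forall x y, chi (line_at l x) = chi (line_at l y).
Proof.
have [D hD] := hales_jewett_seq (enum L) Col; exists D => chi.
have [l [ld lmono]] := hD chi; exists l; split=> // x y.
by apply: lmono; rewrite mem_enum.
Qed.

(** * Ramsey's theorem *)

Definition ramsey_for (k : nat) : Prop :=
  forall (Col : finType) (g : nat), exists n : nat,
    forall (T : finType) (S : {set T}) (chi : {set T} -> Col), n <= #|S| ->
    exists M : {set T}, [/\ M \subset S, #|M| = g &
      forall X Y : {set T}, X \subset M -> Y \subset M ->
        #|X| = k -> #|Y| = k -> chi X = chi Y].

(** A (k+1)-subset of the listed points has the colour stored with its earliest element. *)
Fixpoint end_homogeneous (k : nat) (T Col : finType) (chi : {set T} -> Col)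
    (s : seq (T * Col)) : Prop :=
  if s is (x, i) :: s' then
    (forall Y : {set T}, {subset Y <= unzip1 s'} -> #|Y| = k ->
       chi (x |: Y) = i) /\ end_homogeneous k chi s'
  else True.

Lemma ramsey_end_homogeneous (k : nat) : ramsey_for k ->
  forall (Col : finType) (m : nat), exists n : nat,
    forall (T : finType) (S : {set T}) (chi : {set T} -> Col), n <= #|S| ->
    exists s : seq (T * Col), [/\ uniq (unzip1 s), {subset unzip1 s <= S},
      size s = m & end_homogeneous k chi s].
Proof.
move=> hk Col; elim=> [|m [n hn]].
  by exists 0 => T S chi _; exists [::].
(* [n] points are needed to continue, and [k] to have a set [Y0] from which the colour stored with
   [x] is read. *)
have [n' hn'] := hk Col (maxn n k).
exists n'.+1 => T S chi leS.
have /card_gt0P [x xS] : 0 < #|S| by apply: leq_trans leS.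
have leS' : n' <= #|S :\ x| by move: leS; rewrite (cardsD1 x S) xS.
have [M [MS Mg Mmono]] := hn' T (S :\ x) (fun Y => chi (x |: Y)) leS'.
have [s [us sM ss hs]] : exists s : seq (T * Col),
  [/\ uniq (unzip1 s), {subset unzip1 s <= M}, size s = m
    & end_homogeneous k chi s] by apply: hn; rewrite Mg leq_maxl.
have [Y0 Y0M Y0k] : exists2 Y0 : {set T}, Y0 \subset M & #|Y0| = k.
  by apply: subset_with_card; rewrite Mg leq_maxr.
exists ((x, chi (x |: Y0)) :: s); split=> /=.
- rewrite us andbT; apply/negP => /sM xM.
  by move/subsetP: MS => /(_ _ xM); rewrite !inE eqxx.
- move=> y; rewrite inE => /orP [/eqP->//|/sM yM].
  by move/subsetP: MS => /(_ _ yM); rewrite !inE => /andP [].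
- by rewrite ss.
split=> // Y Ys Yk; apply: Mmono => //.
by apply/subsetP => y /Ys /sM.
Qed.

Lemma end_homogeneous_color (k : nat) (T Col : finType)
    (chi : {set T} -> Col) (s : seq (T * Col)) (i : Col) (X : {set T}) :
  end_homogeneous k chi s -> #|X| = k.+1 ->
  {subset X <= unzip1 [seq p <- s | p.2 == i]} -> chi X = i.
Proof.
elim: s => [|[x j] s IHs] /=.
  by move=> _ cX sX; have /card_gt0P [y /sX] : 0 < #|X| by rewrite cX.
move=> [hx hs] cX sX; case: (boolP (x \in X)) => xX; last first.
  apply: IHs => // y yX; have := sX y yX; case: eqP => _ //=.
  by rewrite inE => /orP [/eqP yx|//]; rewrite -yx yX in xX.
have subs : {subset unzip1 [seq p <- s | p.2 == i] <= unzip1 s}.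
  by move=> y /mapP [p]; rewrite mem_filter => /andP [_ ps] ->; apply: map_f.
case: (altP (j =P i)) sX subs => [<-|ji] sX subs.
  rewrite -(setD1K xX); apply: hx.
    move=> y; rewrite !inE => /andP [yx /sX].
    by rewrite /= inE (negPf yx) => /subs.
  by have := cardsD1 x X; rewrite xX cX => -[].
by apply: IHs.
Qed.

Theorem ramsey (k : nat) : ramsey_for k.
Proof.
elim: k => [|k hk] Col g.
  exists g => T S chi /subset_with_card [M MS cM]; exists M; split=> //.
  by move=> X Y _ _ /cards0_eq-> /cards0_eq->.
(* With this many entries, some colour is stored at least [g] times. *)
have [n hn] := ramsey_end_homogeneous hk Col (#|Col| * g).+1.
exists n => T S chi leS.
have [s [us sS ss hs]] := hn T S chi leS.
have [i gi] : exists i, g <= size [seq p <- s | p.2 == i].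
  apply/existsP; apply: contraT => /existsPn hlt.
  suff: size s <= #|Col| * g by rewrite ss ltnn.
  have -> : size s = \sum_(i : Col) size [seq p <- s | p.2 == i].
    elim: (s) => [|p s' IH] /=; first by rewrite big1.
    rewrite (bigD1 p.2) //= eqxx /= IH [in LHS](bigD1 p.2) //= addSn.
    congr (_ + _).+1; apply: eq_bigr => j jp.
    by rewrite eq_sym (negPf jp).
  rewrite -sum_nat_const; apply: leq_sum => j _.
  by have := hlt j; rewrite -ltnNge => /ltnW.
have subs : {subset unzip1 [seq p <- s | p.2 == i] <= unzip1 s}.
  by move=> y /mapP [p]; rewrite mem_filter => /andP [_ ps] ->; apply: map_f.
have us' : uniq (unzip1 [seq p <- s | p.2 == i]).
  by apply: subseq_uniq us; apply/map_subseq/filter_subseq.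
have [|M /subsetP MN cM] :=
  @subset_with_card T [set y in unzip1 [seq p <- s | p.2 == i]] g.
  by rewrite cardsE (card_uniqP us') size_map.
have Msub : {subset M <= unzip1 [seq p <- s | p.2 == i]}.
  by move=> y /MN; rewrite inE.
exists M; split=> //; first by apply/subsetP => y /Msub /subs /sS.
suff h (X : {set T}) : X \subset M -> #|X| = k.+1 -> chi X = i.
  by move=> X Y XM YM cX cY; rewrite !h.
by move=> /subsetP XM cX; apply: (end_homogeneous_color hs cX) => y /XM /Msub.
Qed.

(** * Partite systems *)

Record psys (I : finType) := PSys {
  pvert : finType;
  pedges : {set {set pvert}};
  pproj : pvert -> I
}.

Section PartiteSystems.

Variables (r t : nat).
Hypothesis htr : t <= r.

Definition partite_system (I : finType) (EI : {set {set I}}) (P : psys I) :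
    Prop :=
  [/\ {in pedges P, forall e : {set pvert P}, #|e| = r},
      {in pedges P &, forall e e' : {set pvert P}, t <= #|e :&: e'| -> e = e'},
      {in pedges P, forall e : {set pvert P}, {in e &, injective (@pproj I P)}}
    & {in pedges P, forall e : {set pvert P}, @pproj I P @: e \in EI}].

Definition strong_emb (V V' : finType) (E : {set {set V}})
    (E' : {set {set V'}}) (f : V -> V') : Prop :=
  [/\ injective f,
      {in E, forall e : {set V}, f @: e \in E'}
    & {in E', forall e' : {set V'}, t <= #|e' :&: f @: setT| ->
        exists2 e : {set V}, e \in E & e' = f @: e}].

(* The transversal strongly induced copies in P of the system with vertex set *)
(* K and edge set EF.                                                         *)
Definition copies (I : finType) (P : psys I) (K : {set I})
    (EF : {set {set I}}) : {set {set pvert P}} :=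
  [set X : {set pvert P} | [&& @pproj I P @: X == K,
     #|@pproj I P @: X| == #|X|,
     [forall e in pedges P, (t <= #|e :&: X|) ==> (e \subset X)]
   & [forall e : {set pvert P}, (e \subset X) ==>
        ((e \in pedges P) == (@pproj I P @: e \in EF))]]].

Lemma copiesP (I : finType) (P : psys I) (K : {set I}) (EF : {set {set I}})
    (X : {set pvert P}) :
  reflect [/\ @pproj I P @: X = K, {in X &, injective (@pproj I P)},
    {in pedges P, forall e : {set pvert P}, t <= #|e :&: X| -> e \subset X}
  & forall e : {set pvert P}, e \subset X ->
     (e \in pedges P) = (@pproj I P @: e \in EF)] (X \in copies P K EF).
Proof.
rewrite inE; apply: (iffP and4P) => [[/eqP h1 h2 h3 h4]|[h1 h2 h3 h4]]; split.
- by [].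
- exact/imset_injP.
- by move=> e eE te; move/forall_inP: h3 => /(_ e eE)/implyP/(_ te).
- by move=> e eX; move/forallP: h4 => /(_ e)/implyP/(_ eX)/eqP.
- exact/eqP.
- exact/imset_injP.
- by apply/forall_inP => e eE; apply/implyP; apply: h3.
- by apply/forallP => e; apply/implyP => eX; apply/eqP; apply: h4.
Qed.

Definition ramsey_family (Col V V' A : finType) (L : A -> V -> V')
    (Phi : {set {set V}}) : Prop :=
  forall chi : {set V'} -> Col, exists a : A,
    {in Phi &, forall X Y : {set V}, chi (L a @: X) = chi (L a @: Y)}.

Definition partite_extension (I : finType) (EI : {set {set I}})
    (P Q : psys I) (A : finType) (L : A -> pvert P -> pvert Q) : Prop :=
  [/\ partite_system EI Q,
      forall a, strong_emb (pedges P) (pedges Q) (L a)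
    & forall a v, pproj (L a v) = pproj v].

Lemma strong_emb_edge (V V' : finType) (E : {set {set V}})
    (E' : {set {set V'}}) (f : V -> V') (e : {set V}) :
  {in E', forall e' : {set V'}, #|e'| = r} -> strong_emb E E' f ->
  (f @: e \in E') = (e \in E).
Proof.
move=> hr [finj fE fE']; apply/idP/idP => [fe|]; last exact: fE.
have [|e' e'E] := fE' _ fe; last by move/(imset_inj finj) ->.
by rewrite (setIidPl _) ?imsetS ?subsetT // hr.
Qed.

Lemma strong_emb_comp (V V' V'' : finType) (E : {set {set V}})
    (E' : {set {set V'}}) (E'' : {set {set V''}}) (f : V -> V') (g : V' -> V'') :
  strong_emb E E' f -> strong_emb E' E'' g -> strong_emb E E'' (g \o f).
Proof.
move=> [fi fE fE'] [gi gE gE']; split; first exact: inj_comp.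
  by move=> e eE; rewrite imset_comp gE ?fE.
move=> e'' e''E; rewrite imset_comp => te.
have [|e' e'E e'def] := gE' _ e''E.
  rewrite (leq_trans te) // subset_leq_card // setIS //.
  by rewrite imsetS ?subsetT.
move: te; rewrite e'def -imsetI ?card_imset //; last by move=> ? ? _ _; apply: gi.
by move=> /(fE' _ e'E) [e eE ->]; exists e => //; rewrite imset_comp.
Qed.

Lemma imset_set_comp (V V' V'' : finType) (f : V -> V') (g : V' -> V'')
    (X : {set V}) : (fun v => g (f v)) @: X = g @: (f @: X).
Proof. exact: imset_comp. Qed.

Lemma imset_proj (I : finType) (P Q : psys I) (f : pvert P -> pvert Q)
    (X : {set pvert P}) :
  (forall v, pproj (f v) = pproj v) ->
  @pproj I Q @: (f @: X) = @pproj I P @: X.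
Proof. by move=> hf; rewrite -imset_comp; apply: eq_imset. Qed.

Lemma strong_emb_copies (I : finType) (EI : {set {set I}}) (P Q : psys I)
    (f : pvert P -> pvert Q) (K : {set I}) (EF : {set {set I}})
    (X : {set pvert P}) :
  partite_system EI Q -> strong_emb (pedges P) (pedges Q) f ->
  (forall v, pproj (f v) = pproj v) ->
  X \in copies P K EF -> f @: X \in copies Q K EF.
Proof.
move=> [hr _ _ _] hf fpr /copiesP [XK Xinj Xcl XE].
have [finj fE fE'] := hf.
apply/copiesP; split.
- by rewrite imset_proj.
- move=> _ _ /imsetP [x xX ->] /imsetP [y yX ->].
  by rewrite !fpr => /Xinj ->.
- move=> e' e'E te; have [|e eE ee'] := fE' _ e'E.
    rewrite (leq_trans te) // subset_leq_card // setIS //.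
    by rewrite imsetS ?subsetT.
  rewrite ee' imsetS //; apply: Xcl => //; move: te.
  by rewrite ee' -imsetI ?card_imset //; move=> ? ? _ _; apply: finj.
- move=> e' /subset_imsetE [e eX ->].
  by rewrite (strong_emb_edge _ hr hf) imset_proj // XE.
Qed.

Definition family_edges (V V' A : finType) (E : {set {set V}})
    (L : A -> V -> V') : {set {set V'}} :=
  [set L p.1 @: (p.2 : {set V}) | p in setX setT E].

Lemma family_edgesP (V V' A : finType) (E : {set {set V}})
    (L : A -> V -> V') (e' : {set V'}) :
  reflect (exists a, exists2 e : {set V}, e \in E & e' = L a @: e)
    (e' \in family_edges E L).
Proof.
apply: (iffP imsetP) => [[[a e]]|[a [e eE ->]]].
  by rewrite inE => /andP [_ /= eE] ->; exists a, e.
by exists (a, e); rewrite // inE in_setT.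
Qed.

(** By the last hypothesis, two edges of different copies that meet in [t] vertices are edges of one
    copy, where the Steiner property of [P] applies. *)
Lemma family_extension (I : finType) (EI : {set {set I}}) (P : psys I)
    (V' A : finType) (pr' : V' -> I) (L : A -> pvert P -> V') :
  partite_system EI P -> (forall a, injective (L a)) ->
  (forall a v, pr' (L a v) = pproj v) ->
  (forall a b (e : {set pvert P}), e \in pedges P ->
    t <= #|L a @: e :&: L b @: setT| ->
    exists2 e' : {set pvert P}, e' \in pedges P & L a @: e = L b @: e') ->
  partite_extension EI (Q := PSys (family_edges (pedges P) L) pr') L.
Proof.
move=> [Pr Pst Pinj PEI] Linj Lpr Lst; split=> //; last first.
  move=> a; split=> //.
    by move=> e eE; apply/family_edgesP; exists a, e.
  by move=> _ /family_edgesP [b [e eE ->]]; apply: Lst.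
have Lpr' a (e : {set pvert P}) : pr' @: (L a @: e) = @pproj I P @: e.
  by rewrite -imset_comp; apply: eq_imset => v /=.
split=> /=.
- by move=> _ /family_edgesP [a [e eE ->]]; rewrite card_imset ?Pr.
- move=> _ _ /family_edgesP [a [e eE ->]] /family_edgesP [b [e' e'E ->]] te.
  have [|e'' e''E ee''] := Lst a b e eE.
    rewrite (leq_trans te) // subset_leq_card // setIS //.
    by rewrite imsetS ?subsetT.
  move: te; rewrite ee'' -imsetI ?card_imset; first by move/Pst=> ->.
    exact: Linj.
  by move=> ? ? _ _; apply: Linj.
- move=> _ /family_edgesP [a [e eE ->]] _ _ /imsetP [x xe ->] /imsetP [y ye ->].
  by rewrite !Lpr => /(Pinj _ eE) ->.
- by move=> _ /family_edgesP [a [e eE ->]]; rewrite Lpr' PEI.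
Qed.

Lemma family_extension_id (I : finType) (EI : {set {set I}}) (P : psys I) :
  partite_system EI P -> partite_extension EI (fun _ : unit => @id (pvert P)).
Proof.
move=> hP; split=> // _; split=> //.
  by move=> e; rewrite imset_id.
by move=> e eE _; exists e; rewrite ?imset_id.
Qed.

(** * Amalgamation *)

Definition psys_over (I : finType) (EF : {set {set I}}) (P : psys I) : psys I :=
  PSys [set e in pedges P | @pproj I P @: e \in EF] (@pproj I P).

Lemma psys_over_system (I : finType) (EI EF : {set {set I}}) (P : psys I) :
  partite_system EI P -> partite_system EF (psys_over EF P).
Proof.
move=> [Pr Pst Pinj PEI]; split=> /=.
- by move=> e; rewrite inE => /andP [/Pr].
- by move=> e e'; rewrite !inE => /andP [eE _] /andP [e'E _]; apply: Pst.
- by move=> e; rewrite inE => /andP [/Pinj].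
- by move=> e; rewrite inE => /andP [].
Qed.

(** A copy contains only edges over [EF], so it survives the removal of the others. The reverse
    inclusion can fail, as a removed edge may meet a set in [t] vertices. *)
Lemma copies_psys_over (I : finType) (EF : {set {set I}}) (P : psys I)
    (K : {set I}) :
  copies P K EF \subset copies (psys_over EF P) K EF.
Proof.
apply/subsetP => X /copiesP [XK Xinj Xcl XE].
apply/copiesP; split=> //=.
  by move=> e; rewrite inE => /andP [eE _]; apply: Xcl.
by move=> e eX; rewrite inE XE ?andbb.
Qed.

Section Amalgamation.

Variables (Col I : finType) (EI EF : {set {set I}}) (K : {set I}).
Variables (P C : psys I) (A : finType) (L : A -> pvert P -> pvert C).
Hypothesis hEF : {in EF, forall e : {set I}, e \subset K}.

(** Copies of [P] are glued along [C] over [K] and kept apart elsewhere by their index in [A]. The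
    points [inr (a, v)] with [v] over [K] are isolated. *)
Definition amalg_vert : finType := (pvert C + A * pvert P)%type.

Definition amalg_proj (x : amalg_vert) : I :=
  match x with inl v => pproj v | inr p => pproj p.2 end.

Definition amalg_emb (a : A) (v : pvert P) : amalg_vert :=
  if pproj v \in K then inl (L a v) else inr (a, v).

Definition amalg : psys I :=
  PSys (family_edges (pedges P) amalg_emb) amalg_proj.

Hypothesis hP : partite_system EI P.
Hypothesis hC : partite_extension EF (P := psys_over EF P) L.
Hypothesis hL : ramsey_family Col L (copies P K EF).
Hypothesis bad : forall (e S : {set pvert P}) (a b : A),
  e \in pedges P -> @pproj I P @: e \notin EF -> S \subset e -> t <= #|S| ->
  @pproj I P @: S \subset K -> L a @: S \subset L b @: setT -> a = b.

Lemma amalg_emb_inj a : injective (amalg_emb a).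
Proof.
have [_ Lst _] := hC; have [Linj _ _] := Lst a.
move=> u v; rewrite /amalg_emb; case: ifP => _; case: ifP => _ //.
  by case=> /Linj.
by case.
Qed.

Lemma amalg_emb_proj a v : amalg_proj (amalg_emb a v) = pproj v.
Proof.
have [_ _ Lpr] := hC.
by rewrite /amalg_emb; case: ifP => _ //=; rewrite Lpr.
Qed.

Lemma amalg_emb_in a (X : {set pvert P}) :
  @pproj I P @: X \subset K -> amalg_emb a @: X = inl @: (L a @: X).
Proof.
move=> XK; rewrite -imset_comp; apply: eq_in_imset => v vX /=.
by rewrite /amalg_emb (subsetP XK) // imset_f.
Qed.

Lemma amalg_emb_meet a b u :
  amalg_emb a u \in amalg_emb b @: setT -> a != b ->
  pproj u \in K /\ L a u \in L b @: setT.
Proof.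
case/imsetP => w _ uw ab; have := congr1 amalg_proj uw.
rewrite !amalg_emb_proj => puw; move: uw; rewrite /amalg_emb -puw.
case: ifP => [uK [->]|_ [abs]]; last by rewrite abs eqxx in ab.
by rewrite imset_f.
Qed.

(** An edge over [EF] lies over [K], hence in [C], where the copies are strongly embedded. For any
    other edge meeting a second copy in [t] vertices, [bad] identifies the two copies. *)
Lemma amalg_extension :
  [/\ partite_extension EI (Q := amalg) amalg_emb,
      ramsey_family Col amalg_emb (copies P K EF)
    & forall a b v, amalg_emb a v \in amalg_emb b @: setT -> a != b ->
        pproj v \in K].
Proof.
have [_ Lst Lpr] := hC.
split; last by move=> a b v /amalg_emb_meet h /h [].
  apply: family_extension => //; first exact: amalg_emb_inj.
    exact: amalg_emb_proj.
  move=> a b e eE te; have [->|ab] := eqVneq a b; first by exists e.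
  pose U := [set u in e | amalg_emb a u \in amalg_emb b @: setT].
  have cU : #|U| = #|amalg_emb a @: e :&: amalg_emb b @: setT|.
    rewrite -(card_imset _ (@amalg_emb_inj a)); apply: eq_card => y.
    apply/imsetP/setIP => [[u]|[/imsetP [u ue ->] h]].
      by rewrite inE => /andP [ue h] ->; rewrite imset_f.
    by exists u => //; rewrite inE ue.
  rewrite -cU in te.
  have UK : @pproj I P @: U \subset K.
    apply/subsetP => _ /imsetP [u + ->].
    by rewrite inE => /andP [_ /amalg_emb_meet/(_ ab) []].
  have UL : L a @: U \subset L b @: setT.
    apply/subsetP => _ /imsetP [u + ->].
    by rewrite inE => /andP [_ /amalg_emb_meet/(_ ab) []].
  have Ue : U \subset e by apply/subsetP => u; rewrite inE => /andP [].
  have [eEF|eEF] := boolP (@pproj I P @: e \in EF); last first.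
    by move: ab; rewrite (bad eE eEF Ue te UK UL) eqxx.
  have [Lainj LaE _] := Lst a; have [_ _ LbE] := Lst b.
  have eB : e \in pedges (psys_over EF P) by rewrite inE eE.
  have [|e' + ee'] := LbE _ (LaE _ eB).
    rewrite (leq_trans te) // -(card_imset _ Lainj) subset_leq_card //.
    by rewrite subsetI UL imsetS.
  rewrite inE => /andP [e'E e'EF]; exists e' => //.
  by rewrite !amalg_emb_in ?ee' // hEF.
move=> chi; have [a ha] := hL (fun X => chi (inl @: X)).
exists a => X Y XC YC; rewrite !amalg_emb_in; first exact: ha.
  by have /copiesP [-> _ _ _] := YC.
by have /copiesP [-> _ _ _] := XC.
Qed.

End Amalgamation.

(** * Iterated amalgamation *)

Definition partite_step (Col I : finType) (EI : {set {set I}}) (P : psys I)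
    (K : {set I}) (EF : {set {set I}}) : Prop :=
  exists (Q : psys I) (A : finType) (L : A -> pvert P -> pvert Q),
  [/\ partite_extension EI L, ramsey_family Col L (copies P K EF)
    & forall a b v, L a v \in L b @: setT -> a != b -> pproj v \in K].

(** Strong embeddings carry copies to copies, so the steps can be settled one at a time. Distinct
    copies in a step meet only over [p.1]; a set that projects into no [p.1] therefore determines
    its index in every step. *)
Lemma iterated_steps (Col I : finType) (EI : {set {set I}})
    (s : seq ({set I} * {set {set I}})) (P : psys I) :
  (forall (Q : psys I) (p : {set I} * {set {set I}}), p \in s ->
     partite_system EI Q -> partite_step Col EI Q p.1 p.2) ->
  partite_system EI P ->
  exists (Q : psys I) (A : finType) (L : A -> pvert P -> pvert Q),
  [/\ partite_extension EI L,
      forall chi : {set pvert Q} -> Col, exists a : A,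
        {in s, forall p : {set I} * {set {set I}},
           {in copies P p.1 p.2 &, forall X Y : {set pvert P},
           chi (L a @: X) = chi (L a @: Y)}}
    & forall (S : {set pvert P}) (a b : A),
        {in s, forall p : {set I} * {set {set I}},
           ~~ (@pproj I P @: S \subset p.1)} ->
        L a @: S \subset L b @: setT -> a = b].
Proof.
elim: s P => [|p s IHs] P hs hP.
  exists P, unit, (fun _ => id); split; first exact: family_extension_id.
    by move=> chi; exists tt.
  by move=> S [] [].
have [P1 [A1 [L1 [ext1 ram1 sep1]]]] := hs P p (mem_head _ _) hP.
have [hP1 L1st L1pr] := ext1.
have [|Q [A2 [L2 [ext2 ram2 sep2]]]] := IHs P1 _ hP1.
  by move=> Q q qs; apply: hs; rewrite inE qs orbT.
have [hQ L2st L2pr] := ext2.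
exists Q, (A2 * A1)%type, (fun a v => L2 a.1 (L1 a.2 v)); split.
- split=> //; last by move=> a v; rewrite L2pr L1pr.
  by move=> a; apply: strong_emb_comp (L1st a.2) (L2st a.1).
(* The later steps are settled first; the colouring is then pulled back along [L2 a2] to the first
   step. *)
- move=> chi; have [a2 ha2] := ram2 chi.
  have [a1 ha1] := ram1 (fun X => chi (L2 a2 @: X)).
  exists (a2, a1) => q; rewrite inE => /orP [/eqP-> | qs] X Y XC YC /=.
    by rewrite !(imset_set_comp (L1 a1)); apply: ha1.
  by rewrite !(imset_set_comp (L1 a1)); apply: (ha2 q) => //;
    apply: strong_emb_copies hP1 (L1st a1) (L1pr a1) _.
- move=> S [a2 a1] [b2 b1] hS /=.
  rewrite (imset_set_comp (L1 a1)) (imset_set_comp (L1 b1)) => sub.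
  have e2 : a2 = b2.
    apply: (sep2 (L1 a1 @: S)).
      by move=> q qs; rewrite imset_proj ?hS // inE qs orbT.
    by apply: subset_trans sub _; apply/imsetS/subsetT.
  rewrite -e2 in sub *; congr (_, _); apply/eqP; apply: contraT => ab.
  case/negP: (hS p (mem_head _ _)).
  apply/subsetP => _ /imsetP [v vS ->]; apply: (sep1 a1 b1) ab.
  have [L2inj _ _] := L2st a2.
  have := subsetP sub (L2 a2 (L1 a1 v)); rewrite !(mem_imset _ _ L2inj).
  by apply; rewrite imset_f.
Qed.

End PartiteSystems.

(** * Partite lemmas *)

Section HalesJewettPower.

Variables (r t : nat).
Variables (I : finType) (K : {set I}) (EF : {set {set I}}) (B : psys I).
Variables (Phi : {set {set pvert B}}) (D : finType).
Hypothesis hEF : {in EF, forall e : {set I}, e \subset K}.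
Hypothesis hB : partite_system r t EF B.
Hypothesis hPhi : Phi \subset copies t B K EF.

Local Notation V := (pvert B).
Local Notation pr := (@pproj I B).

Definition letter : finType := {X : {set V} | X \in Phi}.

Definition vertex_over (X : {set V}) (i : I) : option V :=
  [pick v in X | pr v == i].

Definition power_coord (o : option letter) (v : V) : option V :=
  if o is Some X then vertex_over (val X) (pr v) else Some v.

Definition power_line : finType :=
  {l : {ffun D -> option letter} | [exists d, l d == None]}.

(** [None] is the coordinate, at a fixed letter, of a vertex that is not over [K]. *)
Definition power_vert : finType := (I * {ffun D -> option V})%type.

Definition power_emb (l : power_line) (v : V) : power_vert :=
  (pr v, [ffun d => power_coord (val l d) v]).

Definition power_edge (o : option letter) (e : {set V}) : {set V} :=
  if o is Some X then [set v in val X | pr v \in pr @: e] else e.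

Lemma power_line_moving (l : power_line) : exists d, val l d = None.
Proof. by have /existsP [d /eqP ld] := valP l; exists d. Qed.

Lemma letter_copy (X : letter) : val X \in copies t B K EF.
Proof. exact: subsetP hPhi _ (valP X). Qed.

Lemma vertex_overE (X : letter) v :
  v \in val X -> vertex_over (val X) (pr v) = Some v.
Proof.
move=> vX; have /copiesP [_ Xinj _ _] := letter_copy X.
rewrite /vertex_over; case: pickP => [w /andP [wX /eqP wv]|/(_ v)].
  by rewrite (Xinj w v).
by rewrite vX eqxx.
Qed.

Lemma power_edge_proj o e : e \in pedges B -> pr @: power_edge o e = pr @: e.
Proof.
move=> eE; case: o => [X|] //=; have [_ _ _ BEF] := hB.
have /copiesP [XK _ _ _] := letter_copy X.
apply/setP => i; apply/imsetP/idP => [[v]|ie].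
  by rewrite inE => /andP [_ ve] ->.
have : i \in K by apply: subsetP (hEF (BEF _ eE)) _ ie.
by rewrite -XK => /imsetP [v vX iv]; exists v => //; rewrite inE vX -iv.
Qed.

Lemma power_edge_in o e : e \in pedges B -> power_edge o e \in pedges B.
Proof.
move=> eE; have := power_edge_proj o eE; case: o => [X|] //= eproj.
have [_ _ _ BEF] := hB.
have /copiesP [_ _ _ XE] := letter_copy X.
by rewrite XE ?eproj ?BEF //; apply/subsetP => v; rewrite inE => /andP [].
Qed.

Lemma power_coordP o e u : e \in pedges B -> u \in e ->
  exists u', [/\ power_coord o u = Some u', u' \in power_edge o e
    & pr u' = pr u].
Proof.
move=> eE ue; case: o => [X|] /=; last by exists u.
have : pr u \in pr @: power_edge (Some X) e by rewrite power_edge_proj ?imset_f.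
case/imsetP => v /= + uv; rewrite inE => /andP [vX ve].
by exists v; rewrite uv vertex_overE // inE vX ve.
Qed.

Lemma power_emb_inj l : injective (power_emb l).
Proof.
have [d ld] := power_line_moving l.
by move=> u v [_ /ffunP/(_ d)]; rewrite !ffunE ld => -[].
Qed.

(* Every coordinate of the image of an edge under a line is again an edge of  *)
(* B, over the same edge of EF.                                               *)
Lemma power_emb_strong l l' e : e \in pedges B ->
  t <= #|power_emb l @: e :&: power_emb l' @: setT| ->
  exists2 e', e' \in pedges B & power_emb l @: e = power_emb l' @: e'.
Proof.
move=> eE te; have [d0 ld0] := power_line_moving l'.
have [Br Bst Binj _] := hB.
(* At the moving coordinate [d0] of [l'] vertices appear unchanged, so this is the only
   candidate. *)
pose e' := power_edge (val l d0) e.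
have e'E : e' \in pedges B by apply: power_edge_in.
exists e' => //.
(* In every coordinate the common vertices give at least [t] common vertices of two edges of [B];
   they stay distinct because projections are kept and [e] is transversal. *)
have same d : power_edge (val l d) e = power_edge (val l' d) e'.
  apply: Bst; [exact: power_edge_in | exact: power_edge_in|].
  apply: leq_trans te _; set T := _ :&: _.
  have inT y : y \in T -> exists u v, [/\ u \in e, y = power_emb l u,
      y.2 d = Some v, pr v = pr u & v \in power_edge (val l d) e
      :&: power_edge (val l' d) e'].
    rewrite inE => /andP [/imsetP [u ue yu] /imsetP [w _ yw]].
    have [v [uv ve vu]] := power_coordP (val l d) eE ue.
    have we' : w \in e'.
      have [w' [uw' w'e _]] := power_coordP (val l d0) eE ue.
      have := congr1 (fun z : power_vert => z.2 d0) (etrans (esym yu) yw).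
      by rewrite /= !ffunE ld0 uw' => -[<-].
    have [v' [wv' v'e' _]] := power_coordP (val l' d) e'E we'.
    have vv' : v' = v.
      have := congr1 (fun z : power_vert => z.2 d) (etrans (esym yu) yw).
      by rewrite /= !ffunE uv wv' => -[].
    exists u, v; split=> //; first by rewrite yu /= ffunE.
    by rewrite inE ve -vv'.
  have <- : #|[set y.2 d | y : power_vert in T]| = #|T|.
    apply: card_in_imset => y z /inT [u [v [ue -> uv vu _]]].
    move=> /inT [u1 [v1 [u1e -> uv1 vu1 _]]]; rewrite uv uv1 => -[vv1].
    by congr (power_emb l _); apply: (Binj e) => //; rewrite -vu -vu1 vv1.
  have Sinj : injective (@Some V) by move=> u v [].
  rewrite -(card_imset _ Sinj); apply/subset_leq_card/subsetP => o.
  by case/imsetP => y /inT [u [v [_ _ -> _ vin]]] ->; rewrite imset_f.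
apply/eqP; rewrite eqEcard !card_imset ?Br //; try exact: power_emb_inj.
rewrite leqnn andbT; apply/subsetP => _ /imsetP [u ue ->].
have : pr u \in pr @: e' by rewrite power_edge_proj ?imset_f.
case/imsetP => w we' uw; apply/imsetP; exists w => //.
congr (_, _) => //; apply/ffunP => d; rewrite !ffunE.
have [u' [-> u'e u'u]] := power_coordP (val l d) eE ue.
have [w' [-> w'e w'w]] := power_coordP (val l' d) e'E we'.
congr Some; apply: (Binj (power_edge (val l' d) e')) => //.
- exact: power_edge_in.
- by rewrite -same.
- by rewrite u'u w'w.
Qed.

(** At a moving coordinate of [a] the set [S] appears unchanged. The same coordinate of [b] shows
    vertices of a letter if it is fixed, and vertices of [X] if it moves. *)
Lemma power_emb_copy a b (S X : {set V}) : X \in Phi ->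
  power_emb a @: S \subset power_emb b @: X ->
  exists2 Y : {set V}, Y \in Phi & S \subset Y.
Proof.
move=> XPhi /subsetP sub; have [d ad] := power_line_moving a.
have subd s : s \in S -> exists2 x, x \in X & power_coord (val b d) x = Some s.
  move=> sS; have /imsetP [x xX [_ /ffunP/(_ d)]] := sub _ (imset_f _ sS).
  by rewrite !ffunE ad => xs; exists x.
case bd: (val b d) subd => [Y|] subd; [exists (val Y) | exists X] => //.
- exact: valP.
- apply/subsetP => s /subd [x xX] /=.
  by rewrite /vertex_over; case: pickP => // v /andP [vY _] [<-].
- by apply/subsetP => s /subd [x xX] [<-].
Qed.

Definition power_word (w : {ffun D -> letter}) : {set power_vert} :=
  [set (i, [ffun d => vertex_over (val (w d)) i]) | i in K].

(** The images of the letters under one embedding are the points of its combinatorial line, which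
    [hales_jewett] can make monochromatic. *)
Lemma power_emb_word (l : power_line) (X : letter) :
  power_emb l @: val X = power_word (line_at (val l) X).
Proof.
have /copiesP [XK _ _ _] := letter_copy X.
rewrite /power_word -XK -imset_comp; apply: eq_in_imset => v vX /=.
congr (_, _); apply/ffunP => d; rewrite !ffunE.
by case: (val l d) => [Y|] //=; rewrite vertex_overE.
Qed.

End HalesJewettPower.

(** * The partite lemma and its version with separated copies *)

Section PartiteLemmas.

Variables (r t : nat).
Hypothesis ht : 0 < t.
Hypothesis htr : t <= r.

(** The last clause controls only sets shared with a copy of [F]; separating the copies of [B]
    themselves takes the nested construction. *)
Lemma partite_lemma (Col I : finType) (K : {set I}) (EF : {set {set I}})
    (B : psys I) (Phi : {set {set pvert B}}) :
  {in EF, forall e : {set I}, e \subset K} ->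
  partite_system r t EF B -> Phi \subset copies t B K EF ->
  exists (C : psys I) (A : finType) (L : A -> pvert B -> pvert C),
  [/\ partite_extension r t EF L, ramsey_family Col L Phi
    & forall a b (S X : {set pvert B}), X \in Phi ->
        L a @: S \subset L b @: X ->
        exists2 Y : {set pvert B}, Y \in Phi & S \subset Y].
Proof.
move=> hEF hB hPhi; have [D hD] := hales_jewett (letter Phi) Col.
exists (PSys (family_edges (pedges B) (@power_emb _ _ Phi D)) fst).
exists (power_line Phi D), (@power_emb _ _ Phi D); split.
- apply: family_extension => //; first exact: power_emb_inj.
  by move=> a b e; apply: power_emb_strong hEF hB hPhi _ _ _.
- move=> chi; have [l [[d ld] lmono]] := hD (fun w => chi (power_word K w)).
  have lP : [exists d, l d == None] by apply/existsP; exists d; apply/eqP.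
  exists (exist _ l lP) => X Y XPhi YPhi.
  have /= -> := power_emb_word hPhi (exist _ l lP) (exist _ X XPhi).
  have /= -> := power_emb_word hPhi (exist _ l lP) (exist _ Y YPhi).
  exact: lmono.
- by move=> a b S X; apply: power_emb_copy.
Qed.

(* The copies of B are spread out further by iterated amalgamation over the   *)
(* extension given by [partite_lemma].                                        *)
Lemma clean_partite_lemma (Col I : finType) (K : {set I})
    (EF : {set {set I}}) (B : psys I) (Phi : {set {set pvert B}}) :
  {in EF, forall e : {set I}, e \subset K} ->
  partite_system r t EF B -> Phi \subset copies t B K EF ->
  exists (C : psys I) (A : finType) (L : A -> pvert B -> pvert C),
  [/\ partite_extension r t EF L, ramsey_family Col L Phi
    & forall (S : {set pvert B}) a b, S != set0 ->
        {in Phi, forall X : {set pvert B}, ~~ (S \subset X)} ->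
        L a @: S \subset L b @: setT -> a = b].
Proof.
move=> hEF hB hPhi.
have [C0 [A0 [L0 [[hC0 L0st L0pr] ram0 sep0]]]] :=
  partite_lemma Col hEF hB hPhi.
have [C0r C0st C0inj C0EF] := hC0.
have [Br Bst Binj BEF] := hB.
have L0inj a : injective (L0 a) by have [] := L0st a.
(* The index set is now the vertex set of [C0]; the members [Y] of [Psi], with edge sets [EJ Y],
   take the place of [K] and [EF]. *)
pose EJ (Y : {set pvert C0}) := [set e in pedges C0 | e \subset Y].
pose Psi : {set {set pvert C0}} :=
  [set L0 p.1 @: (p.2 : {set pvert B}) | p in setX setT Phi].
have PsiP a (X : {set pvert B}) : X \in Phi -> L0 a @: X \in Psi.
  by move=> XPhi; apply/imsetP; exists (a, X); rewrite ?inE.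
have Psi_copy (Y : {set pvert C0}) : Y \in Psi -> Y \in copies t C0 K EF.
  case/imsetP => -[a X]; rewrite inE => /andP [_ /= XPhi] -> /=.
  exact (strong_emb_copies htr hC0 (L0st a) (L0pr a) (subsetP hPhi _ XPhi)).
(* The start is a disjoint union of copies of [B], each projected to [C0] by its own embedding. *)
pose emb0 (a : A0) (v : pvert B) : A0 * pvert B := (a, v).
have emb0_inj a : injective (emb0 a) by move=> u v [].
pose P0 := PSys (family_edges (pedges B) emb0)
  (fun p : A0 * pvert B => L0 p.1 p.2 : pvert C0).
have P0pr a (X : {set pvert B}) : @pproj (pvert C0) P0 @: (emb0 a @: X) = L0 a @: X.
  by rewrite -imset_comp; apply: eq_imset.
have emb0I a b (X Y : {set pvert B}) :
    0 < #|emb0 a @: X :&: emb0 b @: Y| -> a = b.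
  by case/card_gt0P => p /setIP [/imsetP [u _ ->] /imsetP [w _ []]].
have emb0st a : strong_emb t (pedges B) (pedges P0) (emb0 a).
  split=> //; first by move=> e eE; apply/family_edgesP; exists a, e.
  move=> _ /family_edgesP [b [e eE ->]] te.
  by exists e => //; rewrite (emb0I b a e setT) // (leq_trans ht te).
have hP0 : partite_system r t (pedges C0) P0.
  split=> /=.
  - by move=> _ /family_edgesP [a [e eE ->]]; rewrite card_imset ?Br.
  - move=> _ _ /family_edgesP [a [e eE ->]] /family_edgesP [b [e' e'E ->]] te.
    have ab := emb0I _ _ _ _ (leq_trans ht te); rewrite -{}ab in te *.
    rewrite -imsetI ?card_imset // in te; last by move=> ? ? _ _; apply: emb0_inj.
    by rewrite (Bst e e').
  - move=> _ /family_edgesP [a [e eE ->]] _ _ /imsetP [x xe ->] /imsetP [y ye ->].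
    by move/L0inj; rewrite /emb0 /= => ->.
  - move=> _ /family_edgesP [a [e eE ->]].
    by have := P0pr a e => /= ->; have [_ h _] := L0st a; apply: h.
have step (Q : psys (pvert C0)) (p : {set pvert C0} * {set {set pvert C0}}) :
    p \in [seq (Y, EJ Y) | Y <- enum Psi] ->
    partite_system r t (pedges C0) Q ->
    partite_step r t Col (pedges C0) Q p.1 p.2.
  case/mapP => Y; rewrite mem_enum => /Psi_copy/copiesP [_ _ Ycl _] -> hQ /=.
  have hEJ : {in EJ Y, forall e : {set pvert C0}, e \subset Y}.
    by move=> e; rewrite inE => /andP [].
  have [C [A [L [Lext Lram _]]]] := partite_lemma Col hEJ
    (psys_over_system (EJ Y) hQ) (copies_psys_over t (EJ Y) Q Y).
  exists (amalg (P := Q) Y L), A, (amalg_emb (P := Q) Y L).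
  apply: (amalg_extension hEJ hQ Lext Lram) => e S a b eE eEJ Se tS SY _.
  (* The premises of [bad] are contradictory here: an edge with [t] vertices over [Y] projects to an
     edge of [C0] meeting [Y] in [t] vertices, and [Y] is strongly induced, so that edge is in
     [EJ Y]. *)
  case/negP: eEJ; have [Qr Qst Qinj QE] := hQ.
  rewrite inE QE //= Ycl ?QE //; apply: leq_trans tS _.
  rewrite -(card_in_imset (f := @pproj (pvert C0) Q) (D := mem S)).
    by rewrite subset_leq_card // subsetI SY andbT imsetS.
  by move=> x y xS yS; apply: (Qinj e) => //; apply: (subsetP Se).
have [Q [A1 [L1 [Q1ext ram1 sep1]]]] := iterated_steps htr step hP0.
have [[Qr Qst Qinj QE] L1st L1pr] := Q1ext.
pose C := PSys (pedges Q) (fun v => pproj (pproj v : pvert C0)).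
pose L (a : A1 * A0) (v : pvert B) : pvert C := L1 a.1 (emb0 a.2 v).
have LE a (X : {set pvert B}) : L a @: X = L1 a.1 @: (emb0 a.2 @: X).
  exact: imset_comp.
exists C, (A1 * A0)%type, L; split.
- split; last 1 first.
  + by move=> a v; rewrite /= L1pr /= L0pr.
  + split=> //=.
      move=> e eE u v ue ve puv; apply: (Qinj e) => //.
      by apply: (C0inj _ (QE _ eE)) => //; rewrite imset_f.
    by move=> e eE; have := C0EF _ (QE _ eE); rewrite -imset_comp.
  + by move=> a; apply: strong_emb_comp (emb0st a.2) (L1st a.1).
- move=> chi; have [a1 ha1] := ram1 chi.
  (* For [Y] in [Psi], the choice of [a1] makes the colour independent of the copy picked;
     [chi set0] is a dummy. *)
  pose chi0 Y := if [pick X in copies t P0 Y (EJ Y)] is Some X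
    then chi (L1 a1 @: X) else chi set0.
  have [a0 ha0] := ram0 chi0; exists (a1, a0) => X Y XPhi YPhi.
  have chi0E Z : Z \in Phi -> chi (L (a1, a0) @: Z) = chi0 (L0 a0 @: Z).
    move=> ZPhi; rewrite LE /chi0.
    have /copiesP [_ Zinj Zcl ZE] := subsetP hPhi _ ZPhi.
    have Zc : emb0 a0 @: Z \in copies t P0 (L0 a0 @: Z) (EJ (L0 a0 @: Z)).
      apply/copiesP; split.
      + exact: P0pr.
      + move=> _ _ /imsetP [x xZ ->] /imsetP [y yZ ->] /L0inj.
        by rewrite /emb0 /= => ->.
      + move=> _ /family_edgesP [b [e eE ->]] te.
        have ab := emb0I _ _ _ _ (leq_trans ht te); rewrite {}ab in te *.
        rewrite -imsetI ?card_imset // in te; last by move=> ? ? _ _; apply: emb0_inj.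
        by rewrite imsetS ?Zcl.
      + move=> e' /(subset_imsetE (f := emb0 a0)) [e eZ ->].
        have [P0r _ _ _] := hP0.
        rewrite (strong_emb_edge htr _ P0r (emb0st a0)) P0pr inE.
        by rewrite (strong_emb_edge htr _ C0r (L0st a0)) imsetS // andbT.
    case: pickP => [W Wc|/(_ (emb0 a0 @: Z))]; last by rewrite Zc.
    apply: (ha1 (L0 a0 @: Z, EJ (L0 a0 @: Z))) => //.
    by apply: map_f; rewrite mem_enum PsiP.
  by rewrite !chi0E //; apply: ha0.
- move=> S [a1 a0] [b1 b0] S0 hS; rewrite !LE /= => sub.
  (* As [S] lies in no member of [Phi], [sep0] shows that its image in [C0] lies in no member of
     [Psi], so [sep1] applies. Disjointness of the initial copies then gives the second index. *)
  have e1 : a1 = b1.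
    apply: (sep1 (emb0 a0 @: S)); last first.
      by apply: subset_trans sub _; rewrite imsetS // subsetT.
    move=> p /mapP [Y + ->]; rewrite mem_enum /= => YPsi; rewrite P0pr.
    case/imsetP: YPsi => -[b X]; rewrite inE => /andP [_ /= XPhi] ->.
    apply/negP => /sep0 [] // Z ZPhi SZ.
    by have := hS Z ZPhi; rewrite SZ.
  rewrite -e1 in sub *; congr (_, _).
  have /set0Pn [s sS] := S0; have [L1inj _ _] := L1st a1.
  have := subsetP sub (L1 a1 (emb0 a0 s)); rewrite !(mem_imset _ _ L1inj).
  by move=> /(_ (imset_f _ sS)) /imsetP [w _ []].
Qed.

End PartiteLemmas.

(** * Order-preserving maps between finite sets *)

Section MonotoneMaps.

Variables (d d' : Order.disp_t) (T : finOrderType d) (T' : finOrderType d').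

Definition increasing_on (S : {set T}) (h : T -> T') : Prop :=
  {in S &, forall x y, (h x < h y)%O = (x < y)%O}.

Lemma increasing_on_inj (S : {set T}) (h : T -> T') :
  increasing_on S h -> {in S &, injective h}.
Proof.
move=> hm x y xS yS hxy; have := hm x y xS yS; have := hm y x yS xS.
by rewrite hxy ltxx; case: ltgtP.
Qed.

Definition rank_in (e : Order.disp_t) (U : finOrderType e) (S : {set U})
    (x : U) : nat := #|[set y in S | (y < x)%O]|.

Lemma rank_in_increasing (e : Order.disp_t) (U : finOrderType e) (S : {set U}) :
  {in S &, forall x y, (rank_in S x < rank_in S y) = (x < y)%O}.
Proof.
have rlt x y : x \in S -> (x < y)%O -> rank_in S x < rank_in S y.
  move=> xS xy; apply: proper_card; apply/properP; split.
    apply/subsetP => z; rewrite !inE => /andP [-> zx].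
    by rewrite (lt_trans zx xy).
  by exists x; rewrite !inE xS ?xy // ltxx.
move=> x y xS yS; case: (ltgtP x y) => [/rlt-> //|/rlt|->].
- by move=> /(_ yS) /ltnW; rewrite leqNgt => /negPf.
- by rewrite ltnn.
Qed.

Lemma rank_in_inj (e : Order.disp_t) (U : finOrderType e) (S : {set U}) :
  {in S &, injective (rank_in S)}.
Proof.
move=> x y xS yS xy; have := rank_in_increasing xS yS.
have := rank_in_increasing yS xS.
by rewrite xy ltnn; case: ltgtP.
Qed.

Lemma rank_in_onto (e : Order.disp_t) (U : finOrderType e) (S : {set U}) i :
  i < #|S| -> exists2 x, x \in S & rank_in S x = i.
Proof.
move=> iS; have rS x : x \in S -> rank_in S x < #|S|.
  move=> xS; apply: proper_card; apply/properP; split.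
    by apply/subsetP => z; rewrite inE => /andP [].
  by exists x; rewrite // !inE ltxx andbF.
pose f x : 'I_#|S|.+1 := inord (rank_in S x).
have fE x : x \in S -> f x = rank_in S x :> nat.
  by move=> xS; rewrite inordK // ltnS ltnW // rS.
have finj : {in S &, injective f}.
  move=> x y xS yS xy; apply: (rank_in_inj xS yS).
  by rewrite -!fE // xy.
have : f @: S = [set j : 'I_#|S|.+1 | j < #|S|].
  apply/eqP; rewrite eqEcard (card_in_imset finj); apply/andP; split.
    by apply/subsetP => _ /imsetP [x xS ->]; rewrite inE fE ?rS.
  have cm := cardsC1 (ord_max : 'I_#|S|.+1); rewrite card_ord /= in cm.
  rewrite -[X in _ <= X]cm subset_leq_card //.
  apply/subsetP => j; rewrite !inE => jS; apply/eqP => jm.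
  by rewrite jm ltnn in jS.
move/setP/(_ (inord i)); rewrite inE inordK ?iS; last by rewrite ltnS ltnW.
case/imsetP => x xS fx; exists x => //.
by rewrite -fE // -fx inordK // ltnS ltnW.
Qed.

Lemma rank_in_imset (S : {set T}) (h : T -> T') x :
  increasing_on S h -> x \in S -> rank_in (h @: S) (h x) = rank_in S x.
Proof.
move=> hm xS; rewrite /rank_in.
have <- : #|h @: [set y in S | (y < x)%O]| = #|[set y in S | (y < x)%O]|.
  apply: card_in_imset => y z; rewrite !inE => /andP [yS _] /andP [zS _].
  exact: (increasing_on_inj hm).
apply: eq_card => z; rewrite inE; apply/andP/imsetP.
  by case=> /imsetP [y yS ->]; rewrite hm // => yx; exists y; rewrite // inE yS.
by case=> y; rewrite inE => /andP [yS yx] ->; rewrite imset_f // hm.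
Qed.

Lemma increasing_on_unique (S : {set T}) (h h' : T -> T') :
  increasing_on S h -> increasing_on S h' -> h @: S = h' @: S ->
  {in S, h =1 h'}.
Proof.
move=> hm hm' hh x xS; apply: (@rank_in_inj _ _ (h @: S)).
- exact: imset_f.
- by rewrite hh imset_f.
- by rewrite rank_in_imset // hh rank_in_imset.
Qed.

Definition transport (x0 : T') (S : {set T}) (S' : {set T'}) (x : T) : T' :=
  odflt x0 [pick y in S' | rank_in S' y == rank_in S x].

Lemma transportP (x0 : T') (S : {set T}) (S' : {set T'}) : #|S| = #|S'| ->
  increasing_on S (transport x0 S S') /\ transport x0 S S' @: S = S'.
Proof.
move=> cS; have tP x : x \in S -> transport x0 S S' x \in S' /\
    rank_in S' (transport x0 S S' x) = rank_in S x.
  move=> xS; rewrite /transport; case: pickP => [y /andP [yS /eqP]|] //=.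
  have [|y yS yx] := @rank_in_onto _ _ S' (rank_in S x).
    rewrite -cS; apply: proper_card; apply/properP; split.
      by apply/subsetP => z; rewrite inE => /andP [].
    by exists x; rewrite // !inE ltxx andbF.
  by move/(_ y); rewrite yS yx eqxx.
have tm : increasing_on S (transport x0 S S').
  move=> x y xS yS; have [xS' xr] := tP x xS; have [yS' yr] := tP y yS.
  by rewrite -(rank_in_increasing xS' yS') xr yr rank_in_increasing.
split=> //; apply/eqP; rewrite eqEcard.
rewrite (card_in_imset (increasing_on_inj tm)) cS leqnn andbT.
by apply/subsetP => _ /imsetP [x xS ->]; have [] := tP x xS.
Qed.

End MonotoneMaps.

(** * Order isomorphisms and projections *)

Lemma order_iso_image (d d' : Order.disp_t) (T : finOrderType d)
    (T' : finOrderType d') (G : hypergraph T) (G' : hypergraph T')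
    (h : T -> T') :
  increasing_on (vertices G) h -> vertices G' = h @: vertices G ->
  (forall e : {set T}, e \subset vertices G ->
     (h @: e \in edges G') = (e \in edges G)) ->
  order_iso G' G.
Proof.
move=> hm VG' EG'; have hinj := increasing_on_inj hm.
have ex (x : vertex G') : exists y : vertex G, h (sval y) = sval x.
  have /imsetP [y yG xy] : sval x \in h @: vertices G by rewrite -VG' (svalP x).
  by exists (exist _ y yG).
have [f fE] := fin_all_exists ex.
have gP (y : vertex G) : h (sval y) \in vertices G'.
  by rewrite VG' imset_f // (svalP y).
exists f; split.
- exists (fun y => exist _ (h (sval y)) (gP y)) => [x|y]; apply: val_inj => /=.
    exact: fE.
  by apply: hinj; rewrite ?(svalP y) ?(svalP (f _)) // fE.
- by move=> x y; rewrite -!fE !leNgt hm //; apply: (svalP (f _)).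
move=> e; rewrite -EG'; last first.
  by apply/subsetP => _ /imsetP [x _ ->]; apply: (svalP (f x)).
suff -> : h @: [set sval (f x) | x in e] = [set sval x | x in e] by [].
by rewrite -imset_comp; apply: eq_imset => x /=; rewrite fE.
Qed.

(** The projected edges depend only on the projected vertex set, because the increasing bijection
    onto it is unique. This is where the order enters. *)
Lemma order_iso_transport (d d' d'' : Order.disp_t) (T : finOrderType d)
    (T' : finOrderType d') (U : finOrderType d'') (F : hypergraph T)
    (G : hypergraph T') (p : T' -> U) (x0 : U) :
  {in edges F, forall e : {set T}, e \subset vertices F} ->
  order_iso G F -> increasing_on (vertices G) p ->
  #|p @: vertices G| = #|vertices F| /\
  forall e : {set T'}, e \subset vertices G ->
    (e \in edges G) = (p @: e \in
       [set transport x0 (vertices F) (p @: vertices G) @: (e' : {set T})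
       | e' in edges F]).
Proof.
move=> Fsub [f [[g fg gf] fle fE]] pm; have pinj := increasing_on_inj pm.
have cGF : #|p @: vertices G| = #|vertices F|.
  rewrite (card_in_imset pinj) -(card_sig (mem (vertices G))).
  by rewrite -[RHS](card_sig (mem (vertices F))); apply: bij_eq_card; exists g.
split=> // e eG; set K := p @: vertices G; set rho := transport _ _ _.
have [rhom rhoK] := @transportP _ _ _ _ x0 _ K (esym cGF).
(* The inverse isomorphism followed by [p], with [x0] as value outside [F]. It is increasing onto
   [K], so it agrees with [rho] on [F]. *)
pose beta (y : T) : U := if insub y is Some y' then p (sval (g y')) else x0.
have betaE (y : vertex F) : beta (sval y) = p (sval (g y)).
  by rewrite /beta valK.
have betam : increasing_on (vertices F) beta.
  move=> x y xF yF; rewrite (betaE (exist _ x xF)) (betaE (exist _ y yF)).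
  by rewrite pm ?(svalP (g _)) // !ltNge -fle !gf.
have betaK : beta @: vertices F = K.
  apply/setP => i; apply/imsetP/imsetP => [[y yF ->]|[x xG ->]].
    exists (sval (g (exist _ y yF))); first exact: (svalP (g _)).
    by rewrite (betaE (exist _ y yF)).
  exists (sval (f (exist _ x xG))); first exact: (svalP (f _)).
  by rewrite betaE fg.
have rhoE : {in vertices F, rho =1 beta}.
  by apply: increasing_on_unique => //; rewrite rhoK betaK.
pose e2 : {set vertex G} := [set x | sval x \in e].
have e2E : [set sval x | x in e2] = e.
  apply/setP => x; apply/imsetP/idP => [[y]|xe]; first by rewrite inE => ye ->.
  by exists (exist _ x (subsetP eG _ xe)); rewrite ?inE.
pose eF := [set sval (f x) | x in e2].
have eFF : eF \subset vertices F.
  by apply/subsetP => _ /imsetP [x _ ->]; apply: (svalP (f x)).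
have rhoF : rho @: eF = p @: e.
  rewrite -[in RHS]e2E -!imset_comp; apply: eq_imset => x /=.
  by rewrite rhoE ?betaE ?fg // (svalP (f x)).
rewrite -[in LHS]e2E -fE -/eF; apply/idP/imsetP => [eFE|[e1 e1E]].
  by exists eF.
rewrite -rhoF => /(imset_inj_in (increasing_on_inj rhom)) -> //.
exact: Fsub.
Qed.

Lemma steiner_meet (T : finType) (r t : nat) (G : hypergraph T) :
  steiner r t G <-> uniform r G /\
    {in edges G &, forall e e' : {set T}, t <= #|e :&: e'| -> e = e'}.
Proof.
split=> -[Gu Gst]; split=> //.
  move=> e e' eE e'E te.
  have [S + cS] := subset_with_card te; rewrite subsetI => /andP [Se Se'].
  have /Gst/card_le1_eqP : S \in rsubsets t (vertices G).
    rewrite inE cS eqxx andbT (subset_trans Se) //.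
    by move/subsetP: Gu => /(_ _ eE); rewrite inE => /andP [].
  by apply; rewrite inE ?eE ?e'E.
move=> S; rewrite inE => /andP [_ /eqP cS]; apply/card_le1_eqP => e e'.
rewrite !inE => /andP [eE Se] /andP [e'E Se']; apply: Gst => //.
by rewrite -cS subset_leq_card // subsetI Se Se'.
Qed.

(** * Steiner systems *)

(* A t-set inside an edge of P that is not over EF lies in no copy, because   *)
(* copies are strongly induced; hence it lies in only one copy of P.          *)
Lemma partite_step_any (r t : nat) (Col I : finType) (K : {set I})
    (EI EF : {set {set I}}) (P : psys I) : 0 < t -> t <= r ->
  {in EF, forall e : {set I}, e \subset K} ->
  partite_system r t EI P -> partite_step r t Col EI P K EF.
Proof.
move=> ht htr hEF hP.
have [C [A [L [Lext Lram Lsep]]]] := clean_partite_lemma ht htr Col hEF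
  (psys_over_system EF hP) (copies_psys_over t EF P K).
exists (amalg (P := P) K L), A, (amalg_emb (P := P) K L).
apply: (amalg_extension hEF hP Lext Lram) => e S a b eE eEF Se tS _.
apply: Lsep; first by rewrite -card_gt0 (leq_trans ht).
move=> X /(@copiesP _ _ P) [_ _ Xcl XE]; apply/negP => SX.
have eX : e \subset X.
  by apply: Xcl => //; rewrite (leq_trans tS) // subset_leq_card // subsetI Se.
by rewrite -XE ?eE in eEF.
Qed.

(** * The initial system of the outer construction *)

Section Spread.

Variables (r t : nat) (d : Order.disp_t) (TG : finOrderType d).
Variables (G : hypergraph TG) (n : nat).
Hypothesis ht : 0 < t.
Hypothesis htr : t <= r.
Hypothesis hG : steiner r t G.

Local Notation I := 'I_n.+1.

Definition spread_proj (M : {set I}) : TG -> I :=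
  transport ord0 (vertices G) M.

Definition spread_emb (M : {set I}) (v : TG) : {set I} * TG := (M, v).

Definition spread_edges : {set {set {set I} * TG}} :=
  [set spread_emb p.1 @: (p.2 : {set TG})
  | p in setX [set M : {set I} | #|M| == #|vertices G|] (edges G)].

(* One copy of G above every subset of the right size; the vertices (M, v)    *)
(* with M of another size or v outside G are isolated.                        *)
Definition spread : psys I :=
  PSys spread_edges (fun p => spread_proj p.1 p.2).

Lemma spread_edgesP (e' : {set {set I} * TG}) :
  reflect (exists M : {set I}, exists e : {set TG},
    [/\ #|M| = #|vertices G|, e \in edges G & e' = spread_emb M @: e])
    (e' \in spread_edges).
Proof.
apply: (iffP imsetP) => [[[M e]]|[M [e [cM eE ->]]]].
  by rewrite !inE => /andP [/= /eqP cM eE] ->; exists M, e.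
by exists (M, e); rewrite // !inE /= cM eqxx eE.
Qed.

Lemma edge_sub (e : {set TG}) : e \in edges G -> e \subset vertices G.
Proof.
by case: hG => /subsetP Gu _ /Gu; rewrite inE => /andP [].
Qed.

Lemma edge_card (e : {set TG}) : e \in edges G -> #|e| = r.
Proof.
by case: hG => /subsetP Gu _ /Gu; rewrite inE => /andP [_ /eqP].
Qed.

Lemma spread_emb_inj M : injective (spread_emb M).
Proof. by move=> u v []. Qed.

Lemma spread_meet M M' (X Y : {set TG}) :
  0 < #|spread_emb M @: X :&: spread_emb M' @: Y| -> M = M'.
Proof. by case/card_gt0P => p /setIP [/imsetP [u _ ->] /imsetP [w _ []]]. Qed.

Lemma spread_meet_card M (X Y : {set TG}) :
  #|spread_emb M @: X :&: spread_emb M @: Y| = #|X :&: Y|.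
Proof.
rewrite -imsetI ?card_imset //; first exact: spread_emb_inj.
by move=> ? ? _ _; apply: spread_emb_inj.
Qed.

Lemma spread_projE M (X : {set TG}) :
  @pproj I spread @: (spread_emb M @: X) = spread_proj M @: X.
Proof. by rewrite -imset_comp; apply: eq_imset. Qed.

Lemma spread_proj_increasing (M : {set I}) : #|M| = #|vertices G| ->
  increasing_on (vertices G) (spread_proj M).
Proof. by move=> cM; have [] := @transportP _ _ _ _ ord0 _ M (esym cM). Qed.

Lemma spread_edge (M : {set I}) (e : {set TG}) : #|M| = #|vertices G| ->
  (spread_emb M @: e \in spread_edges) = (e \in edges G).
Proof.
move=> cM; apply/spread_edgesP/idP => [[M' [e' [_ e'E ee']]]|eE]; last first.
  by exists M, e.
have MM' : M = M'.
  apply: (@spread_meet M M' e e'); rewrite ee' setIid card_imset.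
    by rewrite edge_card // (leq_trans ht).
  exact: spread_emb_inj.
by move: ee'; rewrite -MM' => /(imset_inj (@spread_emb_inj M)) ->.
Qed.

Lemma spread_system : partite_system r t setT spread.
Proof.
have [_ Gst] := (steiner_meet r t G).1 hG.
split=> /=; last by move=> e _; rewrite inE.
- move=> _ /spread_edgesP [M [e [_ eE ->]]].
  by rewrite card_imset ?edge_card //; apply: spread_emb_inj.
- move=> _ _ /spread_edgesP [M [e [_ eE ->]]] /spread_edgesP [M' [e' [_ e'E ->]]].
  move=> te; have MM' := spread_meet (leq_trans ht te).
  by move: te; rewrite -MM' spread_meet_card => /Gst ->.
- move=> _ /spread_edgesP [M [e [cM eE ->]]] _ _ /imsetP [x xe ->] /imsetP [y ye ->].
  have esub := subsetP (edge_sub eE).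
  move=> xy; congr spread_emb.
  exact: (increasing_on_inj (spread_proj_increasing cM) (esub _ xe) (esub _ ye)).
Qed.

Lemma spread_copy (M : {set I}) (W : {set TG}) (EF : {set {set I}}) :
  #|M| = #|vertices G| -> W \subset vertices G ->
  {in edges G, forall e : {set TG}, t <= #|e :&: W| -> e \subset W} ->
  (forall e : {set TG}, e \subset W ->
     (e \in edges G) = (spread_proj M @: e \in EF)) ->
  spread_emb M @: W \in copies t spread (spread_proj M @: W) EF.
Proof.
move=> cM /subsetP WG Wcl WE; apply/copiesP; split.
- exact: spread_projE.
- move=> _ _ /imsetP [x xW ->] /imsetP [y yW ->].
  move=> xy; congr spread_emb.
  exact: (increasing_on_inj (spread_proj_increasing cM) (WG _ xW) (WG _ yW)).
- move=> _ /spread_edgesP [M' [e [_ eE ->]]] te.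
  have MM' := spread_meet (leq_trans ht te).
  by move: te; rewrite MM' spread_meet_card => te; rewrite imsetS ?Wcl.
- move=> e' /(subset_imsetE (f := spread_emb M)) [e eW ->].
  by rewrite spread_projE -WE // -(spread_edge _ cM).
Qed.

End Spread.

(** * From partite systems to ordered systems *)

Section OrderedSystem.

Variables (r t n : nat) (EI : {set {set 'I_n.+1}}) (Q : psys 'I_n.+1).
Hypothesis hQ : partite_system r t EI Q.

(** Projections are compared first and [enum_rank] only breaks ties inside a fibre, so a transversal
    set is ordered like its projection. *)
Definition ordered_vert : finOrderType _ :=
  ('I_n.+1 *l 'I_#|pvert Q|)%type : finOrderType _.

Definition ordered_emb (v : pvert Q) : ordered_vert := (pproj v, enum_rank v).

Definition ordered_system : hypergraph ordered_vert :=
  Hypergraph (ordered_emb @: setT)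
    [set ordered_emb @: (e : {set pvert Q}) | e in pedges Q].

Definition induced_on (W : {set ordered_vert}) : hypergraph ordered_vert :=
  Hypergraph W (edges ordered_system :&: rsubsets r W).

Lemma ordered_emb_inj : injective ordered_emb.
Proof. by move=> u v [_ /enum_rank_inj]. Qed.

Lemma ordered_emb_lt u v : pproj u != pproj v ->
  (ordered_emb u < ordered_emb v)%O = (pproj u < pproj v)%O.
Proof.
by rewrite ltxi_pair; case: (ltgtP (pproj u) (pproj v)).
Qed.

Lemma ordered_edge (e : {set pvert Q}) :
  (ordered_emb @: e \in edges ordered_system) = (e \in pedges Q).
Proof. by rewrite (mem_imset _ _ (imset_inj ordered_emb_inj)). Qed.

Lemma ordered_system_steiner : steiner r t ordered_system.
Proof.
have [Qr Qst _ _] := hQ; apply/steiner_meet; split.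
  apply/subsetP => _ /imsetP [e eE ->]; rewrite inE imsetS ?subsetT //=.
  by rewrite card_imset ?Qr //; apply: ordered_emb_inj.
move=> _ _ /imsetP [e eE ->] /imsetP [e' e'E ->].
rewrite -imsetI ?card_imset; try exact: ordered_emb_inj.
  by move/Qst => ->.
by move=> ? ? _ _; apply: ordered_emb_inj.
Qed.

End OrderedSystem.

Theorem theorem1p8 (r t : nat) (ht : 2 <= t) (htr : t <= r)
    (dF dG : Order.disp_t) (TF : finOrderType dF) (TG : finOrderType dG)
    (F : hypergraph TF) (G : hypergraph TG)
    (hF : steiner r t F) (hG : steiner r t G)
    (c : nat) (hc : 0 < c) :
  exists (dH : Order.disp_t) (TH : finOrderType dH) (H : hypergraph TH),
    steiner r t H /\
    forall col : hypergraph TH -> 'I_c,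
      exists Gt : hypergraph TH,
        copy r t G H Gt /\
        exists i : 'I_c,
          forall K : hypergraph TH, copy r t F Gt K -> col K = i.
Proof.
have t0 : 0 < t by apply: ltnW.
have [n hn] := ramsey #|vertices F| 'I_c #|vertices G|.
pose EF (K : {set 'I_n.+1}) : {set {set 'I_n.+1}} :=
  [set transport ord0 (vertices F) K @: (e : {set TF}) | e in edges F].
pose s := [seq (K, EF K) | K <-
  enum [set K : {set 'I_n.+1} | #|K| == #|vertices F|]].
have hEF (K : {set 'I_n.+1}) : #|K| = #|vertices F| ->
    {in EF K, forall e : {set 'I_n.+1}, e \subset K}.
  move=> cK _ /imsetP [e eE ->].
  have [_ {2}<-] := @transportP _ _ _ _ ord0 _ K (esym cK).
  by rewrite imsetS // (edge_sub hF).
have step (Q : psys 'I_n.+1) (p : {set 'I_n.+1} * {set {set 'I_n.+1}}) :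
    p \in s -> partite_system r t setT Q ->
    partite_step r t 'I_c setT Q p.1 p.2.
  case/mapP => K; rewrite mem_enum inE => /eqP cK -> hQ.
  by apply: partite_step_any => //; apply: hEF.
have [Q [A [L [[hQ Lst Lpr] ram _]]]] :=
  iterated_steps htr step (spread_system n t0 hG).
have [Qr _ _ _] := hQ.
exists _, (ordered_vert Q), (ordered_system Q).
split; first exact: ordered_system_steiner hQ.
move=> col.
pose chi (X : {set pvert Q}) := col (induced_on r (ordered_emb (Q := Q) @: X)).
have [a ha] := ram chi.
(* For [K] of size |V(F)|, [ha] makes the choice of [X] irrelevant; [chi set0] is a dummy. *)
pose psi (K : {set 'I_n.+1}) :=
  if [pick X in copies t (spread G n) K (EF K)] is Some X
  then chi (L a @: X) else chi set0.
have [|M [_ cM Mmono]] := hn _ [set: 'I_n.+1] psi.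
  by rewrite cardsT card_ord.
pose phi (v : TG) : ordered_vert Q := ordered_emb (L a (spread_emb M v)).
have phiE (X : {set TG}) :
    phi @: X = ordered_emb (Q := Q) @: (L a @: (spread_emb M @: X)).
  by rewrite -!imset_comp.
have [Lainj LaE LaE'] := Lst a.
have phi_inj : injective phi.
  by move=> u v /ordered_emb_inj /Lainj /spread_emb_inj.
have phi1 v : (phi v).1 = spread_proj G M v by rewrite /= Lpr.
have rho_inc := spread_proj_increasing cM.
have phi_inc : increasing_on (vertices G) phi.
  move=> u v uG vG; have [->|uv] := eqVneq u v; first by rewrite !ltxx.
  rewrite ordered_emb_lt !Lpr /=; first exact: rho_inc.
  by apply: contra uv => /eqP /(increasing_on_inj rho_inc) -> //.
have phi_edge (e : {set TG}) :
    (phi @: e \in edges (ordered_system Q)) = (e \in edges G).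
  rewrite phiE ordered_edge (strong_emb_edge htr _ Qr (Lst a)).
  exact: (spread_edge t0 htr hG _ cM).
have phi_card (X : {set TG}) : #|phi @: X| = #|X| by rewrite card_imset.
pose Gt := induced_on (Q := Q) r (phi @: vertices G).
have Gt_edge (e : {set TG}) : (phi @: e \in edges Gt) = (e \in edges G).
  rewrite inE phi_edge andb_idr // => eE.
  by rewrite inE phi_card (edge_card hG) // eqxx imsetS // (edge_sub hG).
(* By [LaE'] such an edge comes from an edge of [spread]; copies above different index sets are
   disjoint, so it comes from the copy above [M]. *)
have Gt_closed (e' : {set ordered_vert Q}) : e' \in edges (ordered_system Q) ->
    t <= #|e' :&: vertices Gt| -> e' \in edges Gt.
  case/imsetP => e1 e1E ->.
  rewrite -[vertices Gt]/(phi @: vertices G) phiE -imsetI ?card_imset => [te||].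
  - have [|e2 e2E e12] := LaE' _ e1E.
      rewrite (leq_trans te) // subset_leq_card // setIS //.
      by rewrite imsetS ?subsetT.
    move: te; rewrite e12 -imsetI ?card_imset //; last first.
      by move=> ? ? _ _; apply: Lainj.
    case/spread_edgesP: e2E => M' [e [_ eE ->]] te.
    have -> : M' = M by apply: spread_meet (leq_trans t0 te).
    by rewrite -phiE Gt_edge.
  - exact: ordered_emb_inj.
  - by move=> ? ? _ _; apply: ordered_emb_inj.
exists Gt; split.
  split; last by apply: (@order_iso_image _ _ _ _ G Gt phi).
  split; first by split; rewrite //= phiE imsetS ?subsetT.
  move=> e; rewrite inE => /andP [eGt eH]; rewrite ltnNge; apply/negP => te.
  by rewrite Gt_closed in eGt.
(* Pulled back along [phi], a copy of [F] is strongly induced in [G], hence gives a transversal copy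
   over its projection [J], whose colour [ha] identifies with [psi J]. *)
have key (K : hypergraph (ordered_vert Q)) : copy r t F Gt K ->
    exists J : {set 'I_n.+1},
      [/\ J \subset M, #|J| = #|vertices F| & col K = psi J].
  move=> [[[KGt KE] Kst] Kiso].
  pose W := [set v in vertices G | phi v \in vertices K].
  have WG : W \subset vertices G by apply/subsetP => v; rewrite inE => /andP [].
  have WK : vertices K = phi @: W.
    apply/setP => x; apply/idP/imsetP => [xK|[v]]; last first.
      by rewrite inE => /andP [_ vK] ->.
    have /imsetP [v vG xv] := subsetP KGt _ xK.
    by exists v; rewrite // inE vG -xv.
  have K_edge (e : {set TG}) : e \subset W ->
      (phi @: e \in edges K) = (e \in edges G).
    move=> eW; rewrite KE inE Gt_edge andb_idr // => eE.
    by rewrite inE phi_card (edge_card hG) // eqxx WK imsetS.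
  have p_inc : increasing_on (vertices K) (fun x : ordered_vert Q => x.1).
    rewrite WK => _ _ /imsetP [u uW ->] /imsetP [v vW ->].
    have [uG vG] := (subsetP WG _ uW, subsetP WG _ vW).
    by rewrite !phi1 rho_inc // phi_inc.
  have [cJ JE] := order_iso_transport ord0 (fun e => @edge_sub _ _ _ _ _ hF e)
    Kiso p_inc.
  have pE (X : {set TG}) :
      (fun x : ordered_vert Q => x.1) @: (phi @: X) = spread_proj G M @: X.
    by rewrite -imset_comp; apply: eq_imset => v; apply: phi1.
  rewrite WK pE in cJ JE.
  exists (spread_proj G M @: W); split=> //.
    have [_ {2}<-] := @transportP _ _ _ _ ord0 _ M (esym cM).
    exact: imsetS.
  have Xc : spread_emb M @: W \in
      copies t (spread G n) (spread_proj G M @: W) (EF (spread_proj G M @: W)).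
    apply: (spread_copy t0 htr hG) => // e.
      move=> eE te; apply/subsetP => v ve; rewrite inE.
      rewrite (subsetP (edge_sub hG eE)) //=.
      have eK : phi @: e \in edges K.
        apply: contraLR te => eK; rewrite -ltnNge.
        have := Kst (phi @: e); rewrite inE eK Gt_edge eE WK => /(_ isT).
        by rewrite -imsetI ?phi_card // => ? ? _ _; apply: phi_inj.
      move: eK; rewrite KE !inE => /and3P [_ /subsetP eK _].
      by apply: eK; rewrite imset_f.
    by move=> eW; rewrite -K_edge // JE ?imsetS // pE.
  have -> : col K = chi (L a @: (spread_emb M @: W)).
    congr col; rewrite -phiE; case: (K) KE WK => VK EK /= -> ->.
    congr Hypergraph; apply/setP => e; rewrite !inE -andbA; congr (_ && _).
    have [eW|] := boolP (e \subset phi @: W); last by rewrite !andbF.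
    by rewrite (subset_trans eW) ?imsetS //=; case: eqP.
  rewrite /psi; case: pickP => [X XC|/(_ (spread_emb M @: W))]; last first.
    by rewrite Xc.
  apply: (ha (spread_proj G M @: W, EF (spread_proj G M @: W))) => //.
  by apply: map_f; rewrite mem_enum inE cJ.
pose small (J : {set 'I_n.+1}) := (J \subset M) && (#|J| == #|vertices F|).
(* If no [J] is small, there is no copy of [F] in [Gt] and any colour will do. *)
exists (if [pick J | small J] is Some J then psi J else chi set0) => K.
case/key => J [JM cJ ->]; case: pickP => [J' /andP [J'M /eqP cJ']|/(_ J)].
  exact: Mmono.
by rewrite /small JM cJ eqxx.
Qed.
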